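(* Let $K$ be a commutative field of characteristic zero, let $n\geq 2$ be an integer, and let $(\mathcal{G},\{,\ldots,\})$ be an $n$-Lie algebra over $K$. Then the map $$[\,,]:\left[\Lambda_K^{n-1}(\mathcal{G})/\mathcal{V}_K(\mathcal{G})\right]^2\longrightarrow \Lambda_K^{n-1}(\mathcal{G})/\mathcal{V}_K(\mathcal{G}),\qquad (\overline{s_1},\overline{s_2})\longmapsto \overline{D_{ad_{\mathcal{G}}(s_1)}(s_2)},$$ depends only on the classes $\overline{s_1}$ and $\overline{s_2}$ (i.e. it is well defined), and defines a Lie algebra structure over $K$ on $\Lambda_K^{n-1}(\mathcal{G})/\mathcal{V}_K(\mathcal{G})$. Moreover, the map $$\widetilde{ad_{\mathcal{G}}}:\Lambda_K^{n-1}(\mathcal{G})/\mathcal{V}_K(\mathcal{G})\longrightarrow Der_K(\mathcal{G}),\qquad \overline{s}\longmapsto ad_{\mathcal{G}}(s),$$ is a morphism of $K$-Lie algebras.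
   Context: An $n$-Lie algebra over $K$ is a $K$-vector space $\mathcal{G}$ with a skew-symmetric $n$-multilinear map $\{,\ldots,\}:\mathcal{G}^n\to\mathcal{G}$ such that for all $x_1,\ldots,x_{n-1},y_1,\ldots,y_n\in\mathcal{G}$, $$\{x_1,\ldots,x_{n-1},\{y_1,\ldots,y_n\}\}=\sum_{i=1}^n\{y_1,\ldots,y_{i-1},\{x_1,\ldots,x_{n-1},y_i\},y_{i+1},\ldots,y_n\}.$$ A derivation of $\mathcal{G}$ is a $K$-linear map $D:\mathcal{G}\to\mathcal{G}$ with $D\{x_1,\ldots,x_n\}=\sum_{i=1}^n\{x_1,\ldots,D(x_i),\ldots,x_n\}$ for all $x_1,\ldots,x_n\in\mathcal{G}$; $Der_K(\mathcal{G})$ denotes the set of derivations, a Lie algebra over $K$ for the commutator of endomorphisms. $\Lambda_K^{n-1}(\mathcal{G})$ is the $(n-1)$-st exterior power of the $K$-vector space $\mathcal{G}$. The map $ad_{\mathcal{G}}:\Lambda_K^{n-1}(\mathcal{G})\to Der_K(\mathcal{G})$ is the unique $K$-linear map with $ad_{\mathcal{G}}(x_1\wedge\cdots\wedge x_{n-1})(y)=\{x_1,\ldots,x_{n-1},y\}$ for all $x_1,\ldots,x_{n-1},y\in\mathcal{G}$. For an endomorphism $f$ of a $K$-vector space $W$, $D_f$ is the unique degree-zero derivation of the exterior algebra $\Lambda_K(W)$ with $D_f(w_1\wedge\cdots\wedge w_p)=\sum_{i=1}^p w_1\wedge\cdots\wedge w_{i-1}\wedge f(w_i)\wedge w_{i+1}\wedge\cdots\wedge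 w_p$ for all $p\in\mathbb{N}$ and $w_1,\ldots,w_p\in W$. $\mathcal{V}_K(\mathcal{G})$ is the $K$-subspace of $\Lambda_K^{n-1}(\mathcal{G})$ generated by all elements $D_{ad_{\mathcal{G}}(s_1)}(s_2)+D_{ad_{\mathcal{G}}(s_2)}(s_1)$ with $s_1,s_2\in\Lambda_K^{n-1}(\mathcal{G})$, and $s\mapsto\overline{s}$ is the canonical surjection $\Lambda_K^{n-1}(\mathcal{G})\to\Lambda_K^{n-1}(\mathcal{G})/\mathcal{V}_K(\mathcal{G})$. *)

(* Defs.v *)
From HB Require Import structures.
From mathcomp Require Import all_boot perm all_algebra.
From mathcomp Require Import boolp functions.
From mathcomp Require Import freeg.

Set Implicit Arguments.
Unset Strict Implicit.
Unset Printing Implicit Defensive.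

Import GRing.Theory.
Local Open Scope ring_scope.
Local Open Scope quotient_scope.

Section Span.
Variables (K : fieldType) (V : lmodType K) (A : V -> Prop).

(* The smallest subspace containing A. *)
Definition span_pred : {pred V} := fun v =>
  `[< forall S : {pred V}, submod_closed S -> (forall a, A a -> a \in S) ->
        v \in S >].

Lemma span_predP v :
  reflect (forall S : {pred V}, submod_closed S ->
             (forall a, A a -> a \in S) -> v \in S)
          (v \in span_pred).
Proof. exact: asboolP. Qed.

Lemma mem_span a : A a -> a \in span_pred.
Proof. by move=> Aa; apply/span_predP => S _; apply. Qed.

Fact span_submod_closed : submod_closed span_pred.
Proof.
split=> [|k u v /span_predP uS /span_predP vS].
  by apply/span_predP => S [].
by apply/span_predP => S Scl AS; apply: (Scl.2); [apply: uS | apply: vS].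
Qed.

HB.instance Definition _ :=
  GRing.isSubmodClosed.Build K V span_pred span_submod_closed.

Lemma span_linear0 (W : lmodType K) (f : {linear V -> W}) :
  (forall a, A a -> f a = 0) -> forall v, v \in span_pred -> f v = 0.
Proof.
move=> fA v /span_predP/(_ [pred v | f v == 0]) vS; apply/eqP/vS.
  split=> [|k x y]; rewrite !inE ?linear0 // => /eqP fx /eqP fy.
  by rewrite linearP fx fy scaler0 addr0.
by move=> a /fA; rewrite inE => ->.
Qed.

Definition lquot : Type := {ideal_quot span_pred}.

HB.instance Definition _ := GRing.Zmodule.on lquot.
HB.instance Definition _ := Quotient.on lquot.

Definition lpi (v : V) : lquot := \pi_lquot v.

Lemma lpi_eq u v : (lpi u = lpi v) <-> (u - v \in span_pred).
Proof. by rewrite Quotient.idealrBE; split=> [/eqP|/eqP]. Qed.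

Lemma lpi_surj q : exists v, lpi v = q.
Proof. by exists (repr q); rewrite /lpi reprK. Qed.

Lemma lpi_repr v : repr (lpi v) - v \in span_pred.
Proof. by apply/lpi_eq; rewrite /lpi reprK. Qed.

Let lpiD u v : lpi (u + v) = lpi u + lpi v.
Proof. exact: (raddfD (\pi_{ideal_quot span_pred})). Qed.

Definition lquot_scale (k : K) (q : lquot) : lquot := lpi (k *: repr q).

Let lpiZ k v : lpi (k *: v) = lquot_scale k (lpi v).
Proof.
apply/esym/lpi_eq; rewrite -scalerBr; apply: rpredZ; exact: lpi_repr.
Qed.

Let scaleA a b q : lquot_scale a (lquot_scale b q) = lquot_scale (a * b) q.
Proof. by have [v <-] := lpi_surj q; rewrite -!lpiZ scalerA. Qed.
Let scale1 : left_id 1 lquot_scale.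
Proof. by move=> q; have [v <-] := lpi_surj q; rewrite -lpiZ scale1r. Qed.
Let scaleDr : right_distributive lquot_scale +%R.
Proof.
move=> k p q; have [u <-] := lpi_surj p; have [v <-] := lpi_surj q.
by rewrite -lpiD -!lpiZ scalerDr lpiD.
Qed.
Let scaleDl q : {morph lquot_scale^~ q : a b / a + b}.
Proof.
by move=> a b; have [v <-] := lpi_surj q; rewrite -!lpiZ scalerDl lpiD.
Qed.

HB.instance Definition _ :=
  GRing.Zmodule_isLmodule.Build K lquot scaleA scale1 scaleDr scaleDl.

Fact lpi_is_linear : linear lpi.
Proof. by move=> k u v; rewrite lpiD lpiZ. Qed.
HB.instance Definition _ :=
  GRing.isLinear.Build K V lquot *:%R lpi lpi_is_linear.

Section Lift.
Variables (W : lmodType K) (f : {linear V -> W}).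
Hypothesis fA : forall a, A a -> f a = 0.

Definition lquot_lift (q : lquot) : W := f (repr q).

Lemma lquot_liftE v : lquot_lift (lpi v) = f v.
Proof.
by apply/eqP; rewrite -subr_eq0 -linearB; apply/eqP/span_linear0/lpi_repr.
Qed.

Lemma lquot_lift_is_linear : linear lquot_lift.
Proof.
move=> k p q; have [u <-] := lpi_surj p; have [v <-] := lpi_surj q.
by rewrite -linearP !lquot_liftE linearP.
Qed.
End Lift.

End Span.

Section Multilinear.
Variables (K : fieldType) (p : nat) (V W : lmodType K).
Implicit Types (x : {ffun 'I_p -> V}) (f : {ffun 'I_p -> V} -> W).

Definition upd x (i : 'I_p) (v : V) : {ffun 'I_p -> V} :=
  [ffun j => if j == i then v else x j].

Definition multilinear f := forall x i, linear (fun v => f (upd x i v)).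

Definition alternating f :=
  forall x i j, i != j -> x i = x j -> f x = 0.

Definition skew_symmetric f :=
  forall x (s : 'S_p), f [ffun i => x (s i)] = (-1) ^+ s *: f x.

Lemma updE x i v j : upd x i v j = if j == i then v else x j.
Proof. by rewrite ffunE. Qed.

Lemma upd_id x i : upd x i (x i) = x.
Proof. by apply/ffunP => j; rewrite updE; case: eqP => [->|]. Qed.

Lemma upd_upd x i u v : upd (upd x i u) i v = upd x i v.
Proof. by apply/ffunP => j; rewrite !updE; case: eqP. Qed.

Lemma updC x i j u v : i != j ->
  upd (upd x i u) j v = upd (upd x j v) i u.
Proof.
move=> ij; apply/ffunP => k; rewrite !updE.
by case: (eqVneq k j) => // ->; rewrite eq_sym (negPf ij).
Qed.

Lemma multilinearD f x i u v : multilinear f ->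
  f (upd x i (u + v)) = f (upd x i u) + f (upd x i v).
Proof. by move=> fl; have := fl x i 1 u v; rewrite !scale1r. Qed.

Lemma alternating_swap f x i j u v : multilinear f -> alternating f ->
  i != j ->
  f (upd (upd x i u) j v) + f (upd (upd x i v) j u) = 0.
Proof.
move=> fl fa ij.
have diag w : f (upd (upd x i w) j w) = 0.
  by apply: (fa _ i j) => //; rewrite !updE !eqxx (negPf ij).
have := diag (u + v).
rewrite multilinearD // ![upd (upd x i (u + v)) j _]updC // !multilinearD //.
by rewrite -!(updC x _ _ ij) !diag add0r addr0 addrC.
Qed.

Lemma skew_alternating f : [pchar K] =i pred0 ->
  skew_symmetric f -> alternating f.
Proof.
move=> char0 fs x i j ij xij.
have := fs x (tperm i j); rewrite odd_tperm ij expr1 scaleN1r.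
have -> : [ffun k => x (tperm i j k)] = x.
  by apply/ffunP => k; rewrite ffunE; case: tpermP => [->|->|].
move=> /eqP; rewrite -subr_eq0 opprK -mulr2n -scaler_nat scaler_eq0.
by rewrite ((pcharf0P K).1 char0) //= => /eqP.
Qed.

End Multilinear.

Record altmap (K : fieldType) (p : nat) (V W : lmodType K) := AltMap {
  alt_fun :> {ffun 'I_p -> V} -> W;
  alt_multilinear : multilinear alt_fun;
  alt_alternating : alternating alt_fun
}.

Section ExteriorPower.
Variables (K : fieldType) (p : nat) (V : lmodType K).

Inductive ext_rel : {freeg {ffun 'I_p -> V} / K} -> Prop :=
| ExtLinear (x : {ffun 'I_p -> V}) i k u v :
    ext_rel (<< upd x i (k *: u + v) >> -
               (k *: << upd x i u >> + << upd x i v >>))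
| ExtAlternating (x : {ffun 'I_p -> V}) i j :
    i != j -> x i = x j -> ext_rel << x >>.

(* The p-th exterior power of V, as the quotient of the free vector space on
   V^p by the multilinearity and alternation relations. *)
Definition extpow : lmodType K := lquot ext_rel.

Definition wedge (x : {ffun 'I_p -> V}) : extpow := lpi ext_rel << x >>.

Lemma wedge_multilinear : multilinear wedge.
Proof.
move=> x i k u v; rewrite /wedge -linearP.
by apply/lpi_eq; apply: mem_span; exact: ExtLinear.
Qed.

Lemma wedge_alternating : alternating wedge.
Proof.
move=> x i j ij xij; rewrite /wedge -[0](linear0 (lpi ext_rel)).
by apply/lpi_eq; rewrite subr0; apply: mem_span; exact: ExtAlternating xij.
Qed.

Section Lift.
Variables (W : lmodType K) (f : altmap p V W).

Definition free_lift : {freeg {ffun 'I_p -> V} / K} -> W := fglift f.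

Lemma free_liftU k x : free_lift << k *g x >> = k *: f x.
Proof. exact: liftU. Qed.

Fact free_lift_is_linear : linear free_lift.
Proof.
pose g := HB.pack_for {additive {freeg {ffun 'I_p -> V} / K} -> W} free_lift
  (GRing.isZmodMorphism.Build _ _ _ (@lift_is_additive K _ W f)).
have gD u v : free_lift (u + v) = free_lift u + free_lift v.
  exact: (raddfD g).
have gS r (F : {ffun 'I_p -> V} -> {freeg {ffun 'I_p -> V} / K}) :
  free_lift (\sum_(x <- r) F x) = \sum_(x <- r) free_lift (F x).
  exact: (raddf_sum g).
move=> k u v; rewrite gD; congr (_ + _).
have kE : k *: u = \sum_(x <- dom u) << k * coeff x u *g x >> by [].
rewrite -[in RHS](freeg_sumE u) kE !gS scaler_sumr; apply: eq_bigr => x _.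
by rewrite !free_liftU scalerA.
Qed.
HB.instance Definition _ := GRing.isLinear.Build K
  {freeg {ffun 'I_p -> V} / K} W *:%R free_lift free_lift_is_linear.

Fact free_lift_ext_rel r : ext_rel r -> free_lift r = 0.
Proof.
case=> [x i k u v|x i j ij xij].
  by rewrite linearB linearP /= !free_liftU !scale1r (alt_multilinear f) subrr.
by rewrite free_liftU scale1r (alt_alternating f ij).
Qed.

Definition ext_lift : extpow -> W := lquot_lift free_lift.

Lemma ext_liftE x : ext_lift (wedge x) = f x.
Proof.
rewrite /ext_lift lquot_liftE /=; last exact: free_lift_ext_rel.
by rewrite free_liftU scale1r.
Qed.

Fact ext_lift_is_linear : linear ext_lift.
Proof. exact/lquot_lift_is_linear/free_lift_ext_rel. Qed.
HB.instance Definition _ :=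
  GRing.isLinear.Build K extpow W *:%R ext_lift ext_lift_is_linear.
End Lift.

Lemma ext_eq (W : lmodType K) (f g : {linear extpow -> W}) :
  (forall x, f (wedge x) = g (wedge x)) -> f =1 g.
Proof.
move=> fg s; have [v <-] := lpi_surj s.
rewrite -(freeg_sumE v) !linear_sum; apply: eq_bigr => x _.
have -> : << coeff x v *g x >> = coeff x v *: << x >> :> {freeg _ / K}.
  by apply/eqP/freeg_eqP => y; rewrite coeffZ !coeffU mul1r.
by rewrite !linearZ /= fg.
Qed.

End ExteriorPower.

Section ExteriorDerivation.
Variables (K : fieldType) (p : nat) (V : lmodType K).

Section Leibniz.
Variables (W : lmodType K) (g : {ffun 'I_p -> V} -> W) (f : {linear V -> V}).
Hypotheses (gl : multilinear g) (ga : alternating g).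

Let h x := \sum_i g (upd x i (f (x i))).

Lemma leibniz_multilinear : multilinear h.
Proof.
move=> x i k u v; rewrite /h scaler_sumr -big_split /=; apply: eq_bigr => j _.
rewrite !updE; case: (eqVneq j i) => [->|ji].
  by rewrite !upd_upd linearP gl.
by rewrite ![upd (upd x i _) _ _]updC 1?eq_sym // gl.
Qed.

Lemma leibniz_alternating : alternating h.
Proof.
move=> x i j ij xij; rewrite /h (bigD1 i) //= (bigD1 j) 1?eq_sym //=.
rewrite big1 ?addr0 => [|k /andP[ki kj]]; last first.
  apply: (ga ij); rewrite !updE.
  by rewrite eq_sym (negPf ki) eq_sym (negPf kj).
have -> : upd x i (f (x i)) = upd (upd x i (f (x i))) j (x i).
  apply/ffunP => k; rewrite !updE; case: (eqVneq k j) => // ->.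
  by rewrite eq_sym (negPf ij).
have -> : upd x j (f (x j)) = upd (upd x i (x i)) j (f (x i)).
  by rewrite upd_id xij.
exact: alternating_swap.
Qed.
End Leibniz.

Variable f : {linear V -> V}.

Definition wedge_leibniz : altmap p V (extpow p V) :=
  AltMap (leibniz_multilinear f (@wedge_multilinear K p V))
    (leibniz_alternating f (@wedge_multilinear K p V) (@wedge_alternating K p V)).

(* The restriction to the p-th exterior power of D_f, the degree-zero
   derivation of the exterior algebra extending f; see ext_derE. *)
Definition ext_der : extpow p V -> extpow p V := ext_lift wedge_leibniz.

HB.instance Definition _ := GRing.Linear.on ext_der.

Lemma ext_derE x : ext_der (wedge x) = \sum_i wedge (upd x i (f (x i))).
Proof. exact: ext_liftE. Qed.

End ExteriorDerivation.

Definition lie_bracket (K : fieldType) (L : lmodType K) (b : L -> L -> L) :=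
  [/\ bilinear_for *:%R *:%R b,
      forall x, b x x = 0 &
      forall x y z, b x (b y z) + b y (b z x) + b z (b x y) = 0].

Definition lie_morphism (K : fieldType) (L M : lmodType K)
    (bL : L -> L -> L) (bM : M -> M -> M) (f : L -> M) :=
  linear f /\ forall x y, f (bL x y) = bM (f x) (f y).

(* The family (x_0, ..., x_(n-2), v): the last index of 'I_n is the only one
   that insub does not send to 'I_n.-1. *)
Definition frcons (T : Type) (n : nat) (x : {ffun 'I_n.-1 -> T}) (v : T) :
    {ffun 'I_n -> T} :=
  [ffun i : 'I_n => oapp x v (insub (i : nat))].

HB.mixin Record isNLieAlgebra (K : fieldType) (n : nat) G
    of GRing.Lmodule K G := {
  nlie : {ffun 'I_n -> G} -> G;
  nlie_multilinear : multilinear nlie;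
  nlie_skew : skew_symmetric nlie;
  nlie_fundamental : forall (x : {ffun 'I_n.-1 -> G}) (y : {ffun 'I_n -> G}),
    nlie (frcons x (nlie y)) =
      \sum_i nlie (upd y i (nlie (frcons x (y i))))
}.

#[short(type="nLieAlgType")]
HB.structure Definition NLieAlgebra (K : fieldType) (n : nat) :=
  {G of GRing.Lmodule K G & isNLieAlgebra K n G}.

Section Derivations.
Variables (K : fieldType) (n : nat) (G : nLieAlgType K n).

Definition is_derivation (d : G -> G) :=
  linear d /\
  forall x : {ffun 'I_n -> G}, d (nlie x) = \sum_i nlie (upd x i (d (x i))).

Definition der_pred : {pred G -> G} := fun d => `[< is_derivation d >].

(* Der_K(G), as a subspace of the space of all functions G -> G. *)
Record der : Type := Der { der_fun :> G -> G ; _ : der_fun \in der_pred }.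

HB.instance Definition _ := [isSub for der_fun].
HB.instance Definition _ := [Choice of der by <:].

Fact der_submod_closed : submod_closed der_pred.
Proof.
split=> [|k d e /asboolP[dl dD] /asboolP[el eD]].
  apply/asboolP; split=> [k u v|x]; first by rewrite scaler0 addr0.
  rewrite big1 // => i _.
  have := nlie_multilinear x i 0 0 0; rewrite !scale0r !add0r => e0.
  by have := nlie_multilinear x i (-1) 0 0; rewrite scaleN1r scaleN1r addNr addNr.
apply/asboolP; split=> [a u v|x].
  rewrite !addrfctE !scalrfctE dl el !scalerDr !scalerA [k * a]mulrC.
  by rewrite addrACA.
rewrite !addrfctE !scalrfctE dD eD scaler_sumr -big_split /=.
by apply: eq_bigr => i _; rewrite nlie_multilinear.
Qed.
HB.instance Definition _ :=
  GRing.isSubmodClosed.Build K (G -> G) der_pred der_submod_closed.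
HB.instance Definition _ := [SubChoice_isSubLmodule of der by <:].

Fact der_is_linear (d : der) : linear d.
Proof. by case: d => d /= /asboolP[]. Qed.
HB.instance Definition _ (d : der) :=
  GRing.isLinear.Build K G G *:%R (der_fun d) (der_is_linear d).

Lemma derP (d : der) (x : {ffun 'I_n -> G}) :
  d (nlie x) = \sum_i nlie (upd x i (d (x i))).
Proof. by case: d => d /= /asboolP[]. Qed.

Lemma der_eq (d e : der) : d =1 e -> d = e.
Proof. by move=> de; apply/val_inj/funext. Qed.

Fact commutator_derivation (d e : der) :
  (fun y => d (e y) - e (d y)) \in der_pred.
Proof.
apply/asboolP; split=> [k u v|x].
  by rewrite !linearP /= scalerBr addrACA scalerN.
rewrite !derP !linear_sum /=.
have E (d' e' : der) : \sum_i d' (nlie (upd x i (e' (x i)))) =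
  \sum_i nlie (upd x i (d' (e' (x i)))) +
  \sum_i \sum_(j | j != i) nlie (upd (upd x i (e' (x i))) j (d' (x j))).
  rewrite -big_split /=; apply: eq_bigr => i _; rewrite derP (bigD1 i) //=.
  rewrite upd_upd updE eqxx; congr (_ + _); apply: eq_bigr => j ji.
  by rewrite updE (negPf ji).
have C : \sum_i \sum_(j | j != i) nlie (upd (upd x i (d (x i))) j (e (x j))) =
         \sum_i \sum_(j | j != i) nlie (upd (upd x i (e (x i))) j (d (x j))).
  rewrite (exchange_big_dep predT) //=; apply: eq_bigr => i _.
  apply: eq_big => [j|j ji]; first by rewrite eq_sym.
  by rewrite updC // eq_sym.
rewrite sumrN !E C opprD addrACA subrr addr0 -sumrB; apply: eq_bigr => i _.
have := nlie_multilinear x i (-1) (e (d (x i))) (d (e (x i))).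
by rewrite !scaleN1r [- e _ + _]addrC [- nlie _ + _]addrC.
Qed.

Definition commutator (d e : der) : der := Der (commutator_derivation d e).

Lemma commutator_lie : lie_bracket commutator.
Proof.
split=> [|d|d e f].
- split=> [e k d d'|d k e e']; apply: der_eq => y /=.
    by rewrite linearP /= scalerBr opprD addrACA.
  by rewrite linearP /= scalerBr opprD addrACA.
- by apply: der_eq => y /=; rewrite subrr.
- apply: der_eq => y /=; rewrite !addrfctE /= !linearB /= !opprK !addrA.
  rewrite (ACl ((1*11)*(2*8)*(3*5)*(4*10)*(6*12)*(7*9))%AC) /=.
  by rewrite !subrr !addNr !addr0.
Qed.

End Derivations.

Section Adjoint.
Variables (K : fieldType) (char0 : [pchar K] =i pred0).
Variables (n : nat) (n_ge2 : (2 <= n)%N) (G : nLieAlgType K n).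

Lemma frcons_upd_last (x : {ffun 'I_n.-1 -> G}) :
  exists x0 i, forall v, frcons x v = upd x0 i v.
Proof.
have lt_n : (n.-1 < n)%N by case: n n_ge2.
exists (frcons x 0), (Ordinal lt_n) => v; apply/ffunP => j; rewrite !ffunE.
case: insubP => [k _ kj|/=] /=.
  by case: eqP => // jn; have := ltn_ord k; rewrite kj jn ltnn.
rewrite -leqNgt => lenj; case: eqP => // -[]; apply/val_inj/eqP => /=.
by rewrite eqn_leq lenj -ltnS prednK // ?ltn_ord // (leq_trans _ n_ge2).
Qed.

Definition frcons_widen (i : 'I_n.-1) : 'I_n := widen_ord (leq_pred n) i.

Lemma frcons_upd (x : {ffun 'I_n.-1 -> G}) i u v :
  frcons (upd x i u) v = upd (frcons x v) (frcons_widen i) u.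
Proof.
apply/ffunP => j; rewrite !ffunE.
case: insubP => [k _ kj|/=] /=.
  by rewrite !ffunE -!val_eqE /= kj.
by case: eqP => // ->; rewrite /= ltn_ord.
Qed.

Lemma frcons_widenE (x : {ffun 'I_n.-1 -> G}) v i :
  frcons x v (frcons_widen i) = x i.
Proof. by rewrite ffunE /= valK. Qed.

Fact nlie_frcons_derivation (x : {ffun 'I_n.-1 -> G}) :
  (fun v => nlie (frcons x v)) \in @der_pred K n G.
Proof.
apply/asboolP; split; last by move=> y; exact: nlie_fundamental.
by have [x0 [i E]] := frcons_upd_last x => k u v; rewrite !E nlie_multilinear.
Qed.

Definition ad_decomposable (x : {ffun 'I_n.-1 -> G}) : der G :=
  Der (nlie_frcons_derivation x).

Fact ad_decomposable_multilinear : multilinear ad_decomposable.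
Proof.
move=> x i k u v; apply: der_eq => y /=.
by rewrite addrfctE scalrfctE !frcons_upd nlie_multilinear.
Qed.

Fact ad_decomposable_alternating : alternating ad_decomposable.
Proof.
move=> x i j ij xij; apply: der_eq => y /=.
apply: (skew_alternating char0 (@nlie_skew _ _ G) (i := frcons_widen i)
          (j := frcons_widen j)); last by rewrite !frcons_widenE.
by apply: contra ij => /eqP[ij]; apply/eqP/val_inj.
Qed.

(* ad factors through the exterior power only because skew-symmetric maps are
   alternating in characteristic 0, and n_ge2 gives the linearity in y of
   {x_1, ..., x_(n-1), y}: hence the two proof arguments. *)
Definition ad : extpow n.-1 G -> der G :=
  ext_lift (AltMap ad_decomposable_multilinear ad_decomposable_alternating).

HB.instance Definition _ := GRing.Linear.on ad.

Lemma adE (x : {ffun 'I_n.-1 -> G}) (y : G) :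
  ad (wedge x) y = nlie (frcons x y).
Proof. by rewrite /ad ext_liftE. Qed.

Definition adV_gen (t : extpow n.-1 G) : Prop :=
  exists s1 s2, t = ext_der (ad s1) s2 + ext_der (ad s2) s1.

(* The quotient of the (n-1)-st exterior power of G by V_K(G), the subspace
   generated by adV_gen. *)
Definition ext_mod_adV : lmodType K := lquot adV_gen.

Definition adV_class : extpow n.-1 G -> ext_mod_adV := lpi adV_gen.

HB.instance Definition _ := GRing.Linear.on adV_class.

End Adjoint.

(* Main.v *)
(** The point is the identity [ad (D_d s) = [d, ad s]] for every derivation [d]
    of [G].  It makes [ad] vanish on the generators of [V_K(G)], and, with
    [D_[d, e] = [D_d, D_e]], it turns [D_d] into a derivation of the product
    [(s1, s2) |-> D_(ad s1) s2].  Hence [D_d] preserves [V_K(G)], the product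
    descends to the quotient, where it is skew-symmetric by construction of
    [V_K(G)], and the derivation property is the Jacobi identity. *)
From HB Require Import structures.
Require Import Defs.
From mathcomp Require Import all_boot all_algebra.

Set Implicit Arguments.
Unset Strict Implicit.
Unset Printing Implicit Defensive.

Import GRing.Theory.
Local Open Scope ring_scope.

Lemma span_stable (K : fieldType) (V : lmodType K) (A : V -> Prop)
    (f : {linear V -> V}) :
  (forall a, A a -> f a \in span_pred A) ->
  forall v, v \in span_pred A -> f v \in span_pred A.
Proof.
move=> fA v /span_predP/(_ [pred v | f v \in span_pred A]); apply.
  split=> [|k x y]; rewrite !inE ?linear0 ?rpred0 // => fx fy.
  by rewrite linearP rpredD // rpredZ.
by move=> a /fA; rewrite inE.
Qed.

Section ExteriorDerivationTheory.
Variables (K : fieldType) (p : nat) (V : lmodType K).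
Implicit Types (f g h : {linear V -> V}) (s : extpow p V).

(** Only pointwise agreement is asked of [h], because the linear map carried by the derivation
    [ad (k *: s1 + s2)] is not literally a combination of linear maps. *)
Lemma ext_der_linear_comb k f g h :
  (forall v, h v = k *: f v + g v) ->
  forall s, ext_der h s = k *: ext_der f s + ext_der g s.
Proof.
move=> hE; pose F : {linear extpow p V -> extpow p V} :=
  (k \*: (ext_der f : {linear _ -> _}) \+ (ext_der g : {linear _ -> _})).
apply: (@ext_eq _ _ _ _ (ext_der h) F) => x.
rewrite /F /= !ext_derE scaler_sumr -big_split /=; apply: eq_bigr => i _.
by rewrite hE (wedge_multilinear x i).
Qed.

(** Isolates the terms in which both maps hit the same factor; only these depend on the order of
    composition. *)
Lemma ext_der_comp_wedge f g (x : {ffun 'I_p -> V}) :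
  ext_der f (ext_der g (wedge x)) =
    \sum_i wedge (upd x i (f (g (x i)))) +
    \sum_i \sum_(j | j != i) wedge (upd (upd x i (g (x i))) j (f (x j))).
Proof.
rewrite ext_derE linear_sum -big_split /=; apply: eq_bigr => i _.
rewrite ext_derE (bigD1 i) //= upd_upd updE eqxx; congr (_ + _).
by apply: eq_bigr => j ji; rewrite updE (negPf ji).
Qed.

Lemma ext_der_commutator f g h :
  (forall v, h v = f (g v) - g (f v)) ->
  forall s, ext_der h s = ext_der f (ext_der g s) - ext_der g (ext_der f s).
Proof.
move=> hE; pose D u : {linear extpow p V -> extpow p V} := ext_der u.
apply: (@ext_eq _ _ _ _ (ext_der h) ((D f \o D g) \- (D g \o D f))) => x /=.
rewrite /D !ext_der_comp_wedge ext_derE.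
(* Updates at distinct positions commute, so exchanging [i] and [j] shows that the off-diagonal
   terms are symmetric in [f] and [g]; they cancel. *)
have -> : \sum_i \sum_(j | j != i) wedge (upd (upd x i (g (x i))) j (f (x j))) =
          \sum_i \sum_(j | j != i) wedge (upd (upd x i (f (x i))) j (g (x j))).
  rewrite (exchange_big_dep predT) //=; apply: eq_bigr => i _.
  apply: eq_big => [j|j ji]; first by rewrite eq_sym.
  by rewrite updC // eq_sym.
rewrite opprD addrACA subrr addr0 -sumrB; apply: eq_bigr => i _.
have := wedge_multilinear x i (-1) (g (f (x i))) (f (g (x i))).
by rewrite hE !scaleN1r [- g _ + _]addrC [- wedge _ + _]addrC.
Qed.

End ExteriorDerivationTheory.

(** Separates, in a Leibniz sum over [frcons x y], the slots filled by [x] from the last one. *)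
Lemma sum_frcons_widen (V : nmodType) n (ltn_pn : (n.-1 < n)%N) (F : 'I_n -> V) :
  \sum_i F i = \sum_i F (frcons_widen i) + F (Ordinal ltn_pn).
Proof.
case: n ltn_pn F => // n ltn_pn F; rewrite big_ord_recr /=.
by congr (_ + F _); [apply: eq_bigr => i _; congr F|]; apply: val_inj.
Qed.

Lemma frcons_last T n (ltn_pn : (n.-1 < n)%N) (x : {ffun 'I_n.-1 -> T}) v :
  frcons x v (Ordinal ltn_pn) = v.
Proof. by rewrite ffunE insubF //= ltnn. Qed.

Lemma upd_frcons_last (K : fieldType) (V : lmodType K) n
    (ltn_pn : (n.-1 < n)%N) (x : {ffun 'I_n.-1 -> V}) u v :
  upd (frcons x u) (Ordinal ltn_pn) v = frcons x v.
Proof.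
apply/ffunP => i; rewrite updE; case: eqP => [->|ni].
  by rewrite frcons_last.
rewrite !ffunE; case: insubP => //=; rewrite -leqNgt => le_ni.
case: ni; apply/val_inj/eqP; rewrite eqn_leq le_ni andbT /=.
by rewrite -ltnS prednK // (leq_ltn_trans _ ltn_pn).
Qed.

(** Under skew-symmetry, the Leibniz rule for [b x] is the Jacobi identity; characteristic zero
    turns [2 b x x = 0] into [b x x = 0]. *)
Lemma lie_bracket_of_derivation (K : fieldType) (L : lmodType K)
    (b : L -> L -> L) :
  [pchar K] =i pred0 ->
  (forall y, linear (b^~ y)) -> (forall x, linear (b x)) ->
  (forall x y, b x y + b y x = 0) ->
  (forall x y z, b x (b y z) = b (b x y) z + b y (b x z)) ->
  lie_bracket b.
Proof.
move=> char0 bl br skew deriv; split=> [|x|x y z]; first by split.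
  apply/eqP; have /eqP := skew x x.
  by rewrite -mulr2n -scaler_nat scaler_eq0 ((pcharf0P K).1 char0).
have y0 : b y (b x z) + b y (b z x) = 0.
  have := br y 1 (b x z) (b z x); rewrite !scale1r skew => <-.
  (* Linearity with scalar [-1] at zero vectors gives [b y 0 = 0]. *)
  by have := br y (-1) 0 0; rewrite !scaleN1r !addNr.
by rewrite deriv -addrA [X in _ + X]addrC addrACA skew y0 addr0.
Qed.

Section AdjointQuotient.
Variables (K : fieldType) (char0 : [pchar K] =i pred0).
Variables (n : nat) (n_ge2 : (2 <= n)%N) (G : nLieAlgType K n).
Implicit Types (s t : extpow n.-1 G) (d : der G).

Local Notation ad := (@ad K char0 n n_ge2 G).
Local Notation adV := (@adV_gen K char0 n n_ge2 G).
Local Notation cl := (@adV_class K char0 n n_ge2 G).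

(** Makes [commutator d \o ad] a linear map, so that [ext_eq] can compare it on wedges. *)
Fact commutator_is_linear d : linear (commutator d).
Proof. by have [[_ lin] _ _] := commutator_lie G; exact: lin. Qed.
HB.instance Definition _ d :=
  GRing.isLinear.Build K (der G) (der G) *:%R (commutator d)
    (commutator_is_linear d).

Lemma commutator_skew d e : commutator d e + commutator e d = 0.
Proof. by apply: der_eq => y /=; rewrite addrA addrNK subrr. Qed.

(** By linearity in [s], wedges suffice. There the Leibniz rule for [d] on [{x_1, ..., x_(n-1), y}]
    has [n] terms: the commutator subtracts the last, [{x_1, ..., x_(n-1), d y}], and the others
    form the left-hand side. *)
Lemma ad_ext_der d s : ad (ext_der d s) = commutator d (ad s).
Proof.
apply: (ext_eq (f := ad \o ext_der d) (g := commutator d \o ad)) => x /=.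
apply: der_eq => y; rewrite /= !adE derP ext_derE linear_sum.
have -> : (\sum_i ad (wedge (upd x i (d (x i))))) y =
          \sum_i ad (wedge (upd x i (d (x i)))) y.
  (* Derivations are added pointwise, so evaluation at [y] passes through the sum. *)
  by elim/big_rec2: _ => //= i u v _ <-.
have ltn_pn : (n.-1 < n)%N by rewrite prednK // ltnW.
rewrite (sum_frcons_widen ltn_pn) frcons_last upd_frcons_last addrK.
by apply: eq_bigr => i _; rewrite adE frcons_upd frcons_widenE.
Qed.

Lemma ext_der_ad d s t :
  ext_der d (ext_der (ad s) t) =
    ext_der (ad (ext_der d s)) t + ext_der (ad s) (ext_der d t).
Proof.
rewrite ad_ext_der.
rewrite (@ext_der_commutator _ _ _ d (ad s) (commutator d (ad s))) => [|//].
by rewrite subrK.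
Qed.

(** A generator is sent to [[ad s1, ad s2] + [ad s2, ad s1] = 0]. *)
Lemma ad_adV s : s \in span_pred adV -> ad s = 0.
Proof.
apply: span_linear0 => _ [s1 [s2 ->]].
by rewrite linearD /= !ad_ext_der commutator_skew.
Qed.

Lemma ext_der_adV d s : s \in span_pred adV -> ext_der d s \in span_pred adV.
Proof.
apply: span_stable => _ [s1 [s2 ->]].
(* The four terms regroup into the generators for the pairs [(ext_der d s1, s2)] and
   [(s1, ext_der d s2)]. *)
rewrite linearD /= !ext_der_ad addrACA.
by rewrite [X in _ + X]addrC addrACA [X in _ + X]addrC rpredD //;
  apply: mem_span; do 2!eexists.
Qed.

Lemma adV_class_skew s t :
  cl (ext_der (ad s) t) + cl (ext_der (ad t) s) = 0.
Proof.
rewrite -linearD -[0](linear0 cl); apply/lpi_eq; rewrite subr0.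
by apply: mem_span; do 2!eexists.
Qed.

Lemma ext_der_ad_linearl k s1 s2 t :
  ext_der (ad (k *: s1 + s2)) t =
    k *: ext_der (ad s1) t + ext_der (ad s2) t.
Proof. by apply: ext_der_linear_comb => v; rewrite linearP. Qed.

(** The first argument enters only through [ad], which vanishes on [V_K(G)]; for the second,
    [ext_der (ad s1')] preserves [V_K(G)]. *)
Lemma adV_class_congr s1 s1' s2 s2' : cl s1 = cl s1' -> cl s2 = cl s2' ->
  cl (ext_der (ad s1) s2) = cl (ext_der (ad s1') s2').
Proof.
move=> /lpi_eq/ad_adV; rewrite linearB /= => /subr0_eq -> /lpi_eq V2.
by apply/lpi_eq; rewrite -linearB; apply: ext_der_adV.
Qed.

Lemma adV_class_surj q : exists s, cl s = q.
Proof. exact: lpi_surj. Qed.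

(** Computed on chosen representatives; [adV_bracketE] shows that any others give the same class. *)
Definition adV_bracket (p q : ext_mod_adV char0 n_ge2 G) :
    ext_mod_adV char0 n_ge2 G :=
  cl (ext_der (ad (repr p)) (repr q)).

Local Notation br := adV_bracket.

Lemma adV_bracketE s t : br (cl s) (cl t) = cl (ext_der (ad s) t).
Proof. by apply: adV_class_congr; exact: reprK. Qed.

Lemma adV_bracket_skew p q : br p q + br q p = 0.
Proof. exact: adV_class_skew. Qed.

Lemma adV_bracket_linearl q : linear (br^~ q).
Proof.
move=> k p p' /=; have [s <-] := adV_class_surj p.
have [s' <-] := adV_class_surj p'; have [t <-] := adV_class_surj q.
by rewrite -linearP !adV_bracketE ext_der_ad_linearl linearP.
Qed.

Lemma adV_bracket_linearr p : linear (br p).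
Proof.
move=> k q q'; have [s <-] := adV_class_surj p.
have [t <-] := adV_class_surj q; have [t' <-] := adV_class_surj q'.
by rewrite -linearP !adV_bracketE linearP /= linearP.
Qed.

(** Descends from [ext_der_ad] at [d = ad s]; this is the Jacobi identity in Leibniz form. *)
Lemma adV_bracket_derivation p q r :
  br p (br q r) = br (br p q) r + br q (br p r).
Proof.
have [s <-] := adV_class_surj p; have [t <-] := adV_class_surj q.
have [u <-] := adV_class_surj r.
by rewrite !adV_bracketE ext_der_ad linearD.
Qed.

Lemma adV_bracket_lie : lie_bracket br.
Proof.
apply: lie_bracket_of_derivation => //.
- exact: adV_bracket_linearl.
- exact: adV_bracket_linearr.
- exact: adV_bracket_skew.
- exact: adV_bracket_derivation.
Qed.

Definition ad_quot : ext_mod_adV char0 n_ge2 G -> der G := lquot_lift ad.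

Lemma ad_quotE s : ad_quot (cl s) = ad s.
Proof. by apply: lquot_liftE => t Vt; apply: ad_adV; apply: mem_span. Qed.

(** Compatibility with the brackets is [ad_ext_der] at [d = ad s]. *)
Lemma ad_quot_morphism : lie_morphism br (@commutator K n G) ad_quot.
Proof.
split=> [|p q].
  by apply: lquot_lift_is_linear => t Vt; apply: ad_adV; apply: mem_span.
have [s <-] := adV_class_surj p; have [t <-] := adV_class_surj q.
by rewrite adV_bracketE !ad_quotE ad_ext_der.
Qed.

End AdjointQuotient.

Theorem theorem3 (K : fieldType) (char0 : [pchar K] =i pred0)
    (n : nat) (n_ge2 : (2 <= n)%N) (G : nLieAlgType K n) :
  (* [,] is well defined on classes *)
  (forall s1 s1' s2 s2' : extpow n.-1 G,
     adV_class char0 n_ge2 s1 = adV_class char0 n_ge2 s1' ->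
     adV_class char0 n_ge2 s2 = adV_class char0 n_ge2 s2' ->
     adV_class char0 n_ge2 (ext_der (ad char0 n_ge2 s1) s2) =
     adV_class char0 n_ge2 (ext_der (ad char0 n_ge2 s1') s2'))
  /\
  (exists br : ext_mod_adV char0 n_ge2 G -> ext_mod_adV char0 n_ge2 G ->
               ext_mod_adV char0 n_ge2 G,
     [/\ forall s1 s2 : extpow n.-1 G,
           br (adV_class char0 n_ge2 s1) (adV_class char0 n_ge2 s2) =
           adV_class char0 n_ge2 (ext_der (ad char0 n_ge2 s1) s2),
         lie_bracket br &
         exists adt : ext_mod_adV char0 n_ge2 G -> der G,
           (forall s : extpow n.-1 G,
              adt (adV_class char0 n_ge2 s) = ad char0 n_ge2 s) /\
           lie_morphism br (@commutator K n G) adt]).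
Proof.
split; first exact: adV_class_congr.
exists (@adV_bracket K char0 n n_ge2 G).
split; [exact: adV_bracketE | exact: adV_bracket_lie |].
exists (@ad_quot K char0 n n_ge2 G).
by split; [exact: ad_quotE | exact: ad_quot_morphism].
Qed.
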